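(* Let $G$ be a cubic graph and $M$ a maximal matching of $G$. Then $M$ admits a dominating transversal if and only if the formula $\Phi(G,M)$ is satisfiable. In particular, if $\Phi(G,M)$ is satisfiable for some minimum maximal matching $M$ of $G$, then $\gamma(G) \le \gamma_e(G)$.
   Context: Graphs are finite, simple and undirected; cubic means $3$-regular. The domination number $\gamma(G)$ is the minimum size of a set $S$ of vertices such that every vertex outside $S$ has a neighbour in $S$. A matching is a set of edges no two of which share a vertex; it is maximal if no edge of $G$ can be added to it. The edge domination number $\gamma_e(G)$ is the minimum size of a maximal matching, and a minimum maximal matching is a maximal matching of that size. For a matching $M$, $V(M)$ is the set of vertices lying on edges of $M$; the other vertices are unsaturated. A transversal of $M$ is a set $T \subseteq V(M)$ containing exactly one endpoint of each edge of $M$ (the chosen endpoint); it is dominating if every unsaturated vertex has a neighbour in $T$. An unsaturated vertex $u$ is at risk if its three neighbours lie on three distinct edges of $M$. The formula $\Phi(G,M)$: each edge $e \in M$ carries a Boolean variable $x_e$ whose two truth values name the two endpoints of $e$ (so a truth assignment corresponds to a transversal, the value of $x_e$ naming the chosen endpoint). For an at-risk vertex $u$ with neighbours on the distinct $M$-edges $e_1,e_2,e_3$, let $\ell_i$ be the literal on $x_{e_i}$ that is true exactly when the endpoint of $e_i$ adjacent to $u$ is chosen; the clause of $u$ is $\ell_1 \vee \ell_2 \vee \ell_3$. $\Phi(G,M)$ is the conjunction of the clauses of all at-risk vertices. *)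

(* Defs.v *)
From HB Require Import structures.
From mathcomp Require Import all_boot.

Set Implicit Arguments.
Unset Strict Implicit.
Unset Printing Implicit Defensive.

Record sgraph := SGraph {
  vertex :> finType;
  adj : rel vertex;
  adj_sym : symmetric adj;
  adj_irr : irreflexive adj
}.

Section Graph.
Variable G : sgraph.
Implicit Types (u v x y : G) (f : {set G}) (S : {set G}) (M : {set {set G}}).

Definition nbhd u : {set G} := [set v | adj u v].

Definition cubic : bool := [forall u : G, #|nbhd u| == 3].

Definition edges : {set {set G}} :=
  [set [set x; y] | x in [set: G], y in nbhd x].

Definition dominating S : bool :=
  [forall u in ~: S, [exists v in S, adj u v]].

(* Distinct members of a trivIset are disjoint; V(M) is cover M. *)
Definition matching M : bool := (M \subset edges) && trivIset M.

Definition maximal_matching M : bool :=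
  matching M && [forall f in edges :\: M, ~~ matching (f |: M)].

Lemma ex_dominating : exists n, [exists S, dominating S && (#|S| == n)].
Proof.
exists #|[set: G]|; apply/existsP; exists setT; rewrite eqxx andbT.
by apply/forall_inP => u; rewrite !inE.
Qed.

Lemma ex_maximal_matching :
  exists n, [exists M, maximal_matching M && (#|M| == n)].
Proof.
have m0 : matching set0.
  by rewrite /matching sub0set; apply/trivIsetP => A B; rewrite inE.
case: (@arg_maxnP _ set0 matching (fun M => #|M|) m0) => M mM maxM.
exists #|M|; apply/existsP; exists M; rewrite eqxx andbT /maximal_matching mM.
apply/forall_inP => f; rewrite inE => /andP[fM _]; apply/negP => /maxM.
by rewrite /= cardsU1 fM add1n ltnn.
Qed.

Definition domination_number : nat := ex_minn ex_dominating.

Definition edge_domination_number : nat := ex_minn ex_maximal_matching.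

Definition minimum_maximal_matching M : bool :=
  maximal_matching M && (#|M| == edge_domination_number).

Definition unsaturated M u : bool := u \notin cover M.

(* is_transversal S M (cover M) says that S is a subset of cover M meeting
   every f in M in exactly one vertex; its further requirement that M be a
   partition of cover M holds for every matching. *)
Definition dominating_transversal M S : bool :=
  is_transversal S M (cover M) &&
  [forall (u | unsaturated M u), [exists v in S, adj u v]].

(* For a matching M and v in cover M, pblock M v is the edge of M through v. *)
Definition at_risk M u : bool :=
  [&& unsaturated M u, nbhd u \subset cover M &
      [forall v in nbhd u, [forall w in nbhd u,
         (v != w) ==> (pblock M v != pblock M w)]]].

End Graph.

(* A literal (x, b) is true when x takes the value b; a clause is the
   disjunction of its literals and a formula the conjunction of its clauses. *)
Definition literal (X : finType) : finType := (X * bool)%type.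
Definition clause (X : finType) : finType := {set literal X}.
Definition cnf (X : finType) : finType := {set clause X}.

Definition sat_literal (X : finType) (a : X -> bool) (l : literal X) : bool :=
  a l.1 == l.2.
Definition sat_clause (X : finType) (a : X -> bool) (c : clause X) : bool :=
  [exists l in c, sat_literal a l].
Definition sat_cnf (X : finType) (a : X -> bool) (p : cnf X) : bool :=
  [forall c in p, sat_clause a c].
Definition satisfiable (X : finType) (p : cnf X) : Prop :=
  exists a : X -> bool, sat_cnf a p.

Section Formula.
Variables (G : sgraph) (M : {set {set G}}).

Definition medge : finType := {f : {set G} | f \in M}.

(* How the truth values of each variable name the endpoints of its edge. *)
Record naming := Naming {
  endpoint : medge -> bool -> G;
  endpointP : forall f : medge, val f = [set endpoint f true; endpoint f false]
}.

Lemma naming_exists : matching M -> inhabited naming.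
Proof.
case/andP=> /subsetP ME _.
have H (f : medge) : exists p : G * G, val f == [set p.1; p.2].
  by have /imset2P[x y _ _ ->] := ME _ (valP f); exists (x, y).
pose p f := xchoose (H f).
exists; exists (fun f (b : bool) => if b then (p f).1 else (p f).2) => f.
exact/eqP/(xchooseP (H f)).
Qed.

(* The literal (f, b) is true exactly when the endpoint of f named by b is
   chosen.  If u is at risk, exactly three edges of M contain a neighbour of u,
   and each of them exactly one, so this set consists of the three literals
   l_1, l_2, l_3. *)
Definition risk_clause (nm : naming) (u : G) : clause medge :=
  [set l : literal medge | adj u (endpoint nm l.1 l.2)].

Definition Phi (nm : naming) : cnf medge :=
  [set risk_clause nm u | u : G & at_risk M u].

End Formula.

(* Main.v *)
(* For u unsaturated, maximality of M forces every neighbour of u to be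
   saturated.  If u is not at risk, two neighbours of u are then the two
   endpoints of one edge of M, so every transversal dominates u; if u is at
   risk, a transversal dominates u exactly when its assignment satisfies the
   clause of u.  A dominating transversal T of M is a dominating set of size
   #|M|, because a saturated vertex outside T is adjacent to the other endpoint
   of its edge, which is in T. *)

Require Import Defs.
From HB Require Import structures.
From mathcomp Require Import all_boot.

Set Implicit Arguments.
Unset Strict Implicit.
Unset Printing Implicit Defensive.

Section Graph.
Variable G : sgraph.
Implicit Types (u v x y : G) (f S : {set G}) (M : {set {set G}}).

Lemma edges_set2 x y : ([set x; y] \in edges G) = adj x y.
Proof.
apply/imset2P/idP => [[x' y' _] | xy]; last by exists x y; rewrite ?inE.
rewrite inE => x'y' exy.
(* Since there are no loops, of the four ways to match [x'] and [y'] with [x] and [y] only the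
   identity and the swap survive. *)
have nx'y' : x' != y' by apply: contraL x'y' => /eqP ->; rewrite adj_irr.
have : x' \in [set x; y] by rewrite exy set21.
have : y' \in [set x; y] by rewrite exy set22.
rewrite !inE => /orP[]/eqP ey /orP[]/eqP ex; subst x' y' => //.
- by rewrite eqxx in nx'y'.
- by rewrite adj_sym.
- by rewrite eqxx in nx'y'.
Qed.

(** An edge contains a vertex, so the empty set is not in [M]; this supplies the partition that
    [is_transversal] demands. *)
Lemma partition_matching M : matching M -> partition M (cover M).
Proof.
case/andP=> /subsetP ME tM; rewrite /partition eqxx tM /=.
by apply/negP => /ME/imset2P[x y _ _ /setP/(_ x)]; rewrite !inE eqxx.
Qed.

(** If a neighbour [v] of [u] were unsaturated too, [[set u; v]] would be an edge disjoint from
    every edge of [M] and could be added. *)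
Lemma maximal_matching_nbhd_sub M u :
  maximal_matching M -> unsaturated M u -> nbhd u \subset cover M.
Proof.
case/andP=> mM /forall_inP maxM uM; apply/subsetP => v; rewrite inE => uv.
case/andP: mM => ME tM; apply: contraT => vM.
have disj B : B \in M -> [disjoint [set u; v] & B].
  move=> BM; rewrite disjoint_sym disjoint_subset; apply/subsetP => w wB.
  have wM : w \in cover M by apply/bigcupP; exists B.
  rewrite !inE negb_or; apply/andP.
  by split; [apply: contraNneq uM | apply: contraNneq vM] => <-.
have uvM : [set u; v] \notin M.
  by apply: contraNN uM => uvM; apply/bigcupP; exists [set u; v]; rewrite ?set21.
have := maxM [set u; v]; rewrite inE uvM edges_set2 uv => /(_ isT)/negP[].
rewrite /matching subUset sub1set edges_set2 uv ME /=.
apply/trivIsetP => A B; rewrite !inE.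
case/predU1P=> [->|AM] /predU1P[->|BM]; first by rewrite eqxx.
- by move=> _; apply: disj.
- by move=> _; rewrite disjoint_sym; apply: disj.
- by move/trivIsetP: tM; apply.
Qed.

End Graph.

Section Endpoints.
Variables (G : sgraph) (M : {set {set G}}) (nm : naming M).
Hypothesis matchingM : matching M.
Implicit Types (e : medge M) (b : bool) (u v : G) (S : {set G}).
Implicit Type a : medge M -> bool.

Lemma endpoint_in e b : endpoint nm e b \in val e.
Proof. by rewrite (endpointP nm e); case: b; rewrite !inE eqxx ?orbT. Qed.

Lemma endpoint_cover e b : endpoint nm e b \in cover M.
Proof. by apply/bigcupP; exists (val e); rewrite ?endpoint_in ?(valP e). Qed.

Lemma coverE v : v \in cover M -> exists e b, v = endpoint nm e b.
Proof.
case/bigcupP=> f fM vf; have := endpointP nm (Sub f fM); rewrite SubK => ef.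
by move: vf; rewrite ef !inE => /orP[]/eqP->; do 2 eexists.
Qed.

Lemma pblock_endpoint e b : pblock M (endpoint nm e b) = val e.
Proof.
case/andP: matchingM => _ tM.
exact: def_pblock tM (valP e) (endpoint_in e b).
Qed.

Lemma adj_endpoint e b : adj (endpoint nm e b) (endpoint nm e (~~ b)).
Proof.
case/andP: matchingM => /subsetP/(_ _ (valP e)); rewrite (endpointP nm e).
by rewrite edges_set2 => tf _; case: b => //; rewrite adj_sym.
Qed.

(** The two endpoints of an edge are adjacent and [adj] is irreflexive, so they differ. *)
Lemma endpoint_eq e b c : (endpoint nm e b == endpoint nm e c) = (b == c).
Proof.
have [->|nbc] := eqVneq b c; first by rewrite eqxx.
have := adj_endpoint e b; have -> : ~~ b = c by case: b c nbc => [] [].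
by move=> bc; apply: contraTF bc => /eqP->; rewrite adj_irr.
Qed.

(** Exactly one endpoint of [e] lies in [S], so the status of the endpoint named [true] settles
    both. This reads [S] as a truth assignment. *)
Lemma in_transversal S e b :
  is_transversal S M (cover M) ->
  (endpoint nm e b \in S) = ((endpoint nm e true \in S) == b).
Proof.
case/and3P=> _ _ /forall_inP/(_ _ (valP e))/cards1P[x /setP Sx].
have xe : x \in val e by have := Sx x; rewrite !inE eqxx => /andP[].
have inS c : (endpoint nm e c \in S) = (endpoint nm e c == x).
  by have := Sx (endpoint nm e c); rewrite !inE endpoint_in andbT.
have [d xd] : exists d, x = endpoint nm e d.
  by move: xe; rewrite (endpointP nm e) !inE => /orP[]/eqP->; eexists.
by rewrite !inS xd !endpoint_eq; case: b d {xd} => [] [].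
Qed.

(** The passage back, from assignments to transversals. *)
Definition chosen a : {set G} := [set endpoint nm e (a e) | e : medge M].

(** Edges of [M] are disjoint, so a vertex determines its edge through [pblock], and then its truth
    value by [endpoint_eq]. *)
Lemma in_chosen a e b : (endpoint nm e b \in chosen a) = (a e == b).
Proof.
apply/imsetP/eqP => [[g _ eq_eg] | <-]; last by exists e.
have eg : e = g.
  by apply: val_inj; rewrite -(pblock_endpoint e b) eq_eg pblock_endpoint.
by move/eqP: eq_eg; rewrite -eg endpoint_eq => /eqP.
Qed.

Lemma chosen_transversal a : is_transversal (chosen a) M (cover M).
Proof.
apply/and3P; split; first exact: partition_matching.
  by apply/subsetP => _ /imsetP[e _ ->]; apply: endpoint_cover.
apply/forall_inP => f fM; pose e : medge M := Sub f fM.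
apply/cards1P; exists (endpoint nm e (a e)); apply/setP => v.
rewrite -[f]/(val e) 2!inE; apply/andP/eqP => [[vS] | ->]; last first.
  by rewrite in_chosen eqxx endpoint_in.
rewrite (endpointP nm e) !inE => /orP[]/eqP ev.
all: by move: vS; rewrite ev in_chosen => /eqP->.
Qed.

Lemma transversal_satisfiable S :
  dominating_transversal M S -> satisfiable (Phi nm).
Proof.
case/andP=> trS /forall_inP domS.
exists (fun e => endpoint nm e true \in S).
apply/forall_inP => _ /imsetP[u + ->]; rewrite inE => /and3P[uM _ _].
(* The neighbour [v] that dominates [u] provides the true literal in the clause of [u]. *)
have /exists_inP[v vS uv] := domS u uM.
have /subsetP/(_ _ vS)/coverE[e [b ev]] := transversal_sub trS.
apply/exists_inP; exists (e, b); first by rewrite inE /= -ev.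
by rewrite /sat_literal /= -in_transversal // -ev.
Qed.

Lemma dominating_transversal_dominating S :
  dominating_transversal M S -> dominating S.
Proof.
case/andP=> trS /forall_inP domS; apply/forall_inP => u; rewrite inE => uS.
have [/coverE[e [b eu]] | /domS//] := boolP (u \in cover M).
apply/exists_inP; exists (endpoint nm e (~~ b)); last by rewrite eu adj_endpoint.
move: uS; rewrite eu (in_transversal e b trS) (in_transversal e (~~ b) trS).
by case: (_ \in S) (b) => [] [].
Qed.

End Endpoints.

Lemma satisfiable_transversal (G : sgraph) (M : {set {set G}}) (nm : naming M) :
  maximal_matching M -> satisfiable (Phi nm) ->
  exists S : {set G}, dominating_transversal M S.
Proof.
move=> maxM [a /forall_inP sat_a]; have /andP[mM _] := maxM.
exists (chosen nm a); rewrite /dominating_transversal chosen_transversal //=.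
apply/forall_inP => u uM; have nuM := maximal_matching_nbhd_sub maxM uM.
have [risk_u | ] := boolP (at_risk M u).
  have /sat_a/exists_inP[[e b]] : risk_clause nm u \in Phi nm.
    by apply/imsetP; exists u; rewrite ?inE.
  rewrite inE => uv sat_eb.
  by apply/exists_inP; exists (endpoint nm e b); rewrite ?in_chosen.
(* Only the last condition of [at_risk] can fail here, which leaves distinct neighbours [v] and [w]
   of [u] on the same edge of [M]. *)
rewrite /at_risk uM nuM /= => /forall_inPn[v uv /forall_inPn[w uw]].
rewrite negb_imply negbK => /andP[nvw].
have /(@coverE _ _ nm)[e [b ev]] := subsetP nuM _ uv.
have /(@coverE _ _ nm)[g [c ew]] := subsetP nuM _ uw.
rewrite ev ew !pblock_endpoint // => /eqP/val_inj eg; subst g.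
rewrite !inE in uv uw.
(* If [a] does not choose [v] on [e], it chooses the other endpoint [w]. *)
have [aeb | nab] := eqVneq (a e) b; apply/exists_inP.
  by exists v; rewrite // ev in_chosen // aeb.
exists w; rewrite // ew in_chosen //.
by move: nvw nab; rewrite ev ew endpoint_eq //; case: (a e) (b) (c) => [] [] [].
Qed.

Theorem proposition6 (G : sgraph) (Gcubic : cubic G) :
  (forall M : {set {set G}}, maximal_matching M ->
     forall nm : naming M,
       (exists S : {set G}, dominating_transversal M S) <->
       satisfiable (Phi nm))
  /\
  ((exists M : {set {set G}}, minimum_maximal_matching M /\
      exists nm : naming M, satisfiable (Phi nm)) ->
   domination_number G <= edge_domination_number G).
Proof.
split=> [M maxM nm | [M [/andP[maxM /eqP cardM] [nm satM]]]].
  have /andP[mM _] := maxM.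
  split=> [[S] | ]; first exact: transversal_satisfiable.
  exact: satisfiable_transversal.
have [S domS] := satisfiable_transversal maxM satM.
have /andP[mM _] := maxM; have /andP[trS _] := domS.
(* A transversal has one vertex per edge, so [S] has the size of [M] and competes in the minimum
   defining [domination_number]. *)
rewrite -cardM -(card_transversal trS) /domination_number.
case: ex_minnP => n _; apply; apply/existsP; exists S.
by rewrite eqxx andbT (dominating_transversal_dominating nm).
Qed.
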